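(* For every $\varphi\in\mathit{Fm}$, $\vdash_{\mathrm{HPRL}^{re}}\varphi$ if and only if $\vdash_{\mathrm{HPRL}}\varphi$.
   Context: Language $\{\land,\lor,\longrightarrow,\neg,I,C,0,1\}$ with arities $2,2,2,1,1,1,0,0$; $\mathit{Fm}$ is the set of formulas over a countably infinite set $V$ of variables; $\mathrm{var}(\varphi)$ is the set of variables of $\varphi$. Both logics are Hilbert-style (theorems are formulas derivable from no hypotheses via finite sequences of axiom instances and rule applications) with the axiom schemes: (A1) $\alpha\longrightarrow\neg\neg\alpha$; (A2) $\neg\neg\alpha\longrightarrow\alpha$; (A3) $(\alpha\land\beta)\longrightarrow\beta$; (A4) $(\alpha\land\beta)\longrightarrow(\beta\land\alpha)$; (A5) $(\alpha\land(\beta\lor\gamma))\longrightarrow((\alpha\land\beta)\lor(\alpha\land\gamma))$; (A6) $((\alpha\land\beta)\lor(\alpha\land\gamma))\longrightarrow(\alpha\land(\beta\lor\gamma))$; (A7) $(\alpha\lor\beta)\longrightarrow\neg(\neg\alpha\land\neg\beta)$; (A8) $\neg(\neg\alpha\land\neg\beta)\longrightarrow(\alpha\lor\beta)$; (A9) $C\alpha\longrightarrow\neg I\neg\alpha$; (A10) $\neg I\neg\alpha\longrightarrow C\alpha$; (A11) $I\alpha\longrightarrow\alpha$; (A12) $(I\alpha\land I\beta)\longrightarrow I(\alpha\land\beta)$; (A13) $(\alpha\longrightarrow\beta)\longrightarrow((\neg I\alpha\lor I\beta)\land(\neg C\alpha\lor C\beta))$; (A14) $((\neg I\alpha\lor I\beta)\land(\neg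 C\alpha\lor C\beta))\longrightarrow(\alpha\longrightarrow\beta)$. HPRL has the rules: (R1) from $\alpha$ and $\alpha\longrightarrow\beta$ infer $\beta$; (R2) from $\alpha\longrightarrow\beta$ and $\beta\longrightarrow\gamma$ infer $\alpha\longrightarrow\gamma$; (R3) from $\alpha$ infer $\beta\longrightarrow\alpha$; (R4) from $\alpha\longrightarrow\beta$ infer $\neg\beta\longrightarrow\neg\alpha$; (R5) from $\alpha\longrightarrow\beta$, $\alpha\longrightarrow\gamma$ infer $\alpha\longrightarrow(\beta\land\gamma)$; (R6) from $\alpha\longrightarrow\beta$, $\beta\longrightarrow\alpha$, $\gamma\longrightarrow\delta$, $\delta\longrightarrow\gamma$ infer $(\alpha\longrightarrow\gamma)\longrightarrow(\beta\longrightarrow\delta)$; (R7) from $\alpha\longrightarrow\beta$ infer $I\alpha\longrightarrow I\beta$; (R8) from $\alpha$ infer $I\alpha$; (R9) from $I\alpha\longrightarrow I\beta$ and $C\alpha\longrightarrow C\beta$ infer $\alpha\longrightarrow\beta$. $\mathrm{HPRL}^{re}$ has the same axioms and rules (R3)–(R9), but (R1) and (R2) replaced by: (R1$'$) (R1) provided $\mathrm{var}(\alpha)\subseteq\mathrm{var}(\beta)$; (R2$'$) (R2) provided $\mathrm{var}(\beta)\subseteq\mathrm{var}(\alpha)\cup\mathrm{var}(\gamma)$. *)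

(* Defs.v *)
From Stdlib Require Import List.
Import ListNotations.

(* The countably infinite set V of propositional variables is nat. *)
Inductive Fm : Type :=
| Var (p : nat)
| And (a b : Fm)
| Or (a b : Fm)
| Imp (a b : Fm)
| Neg (a : Fm)
| FI (a : Fm)
| FC (a : Fm)
| Zero
| One.

Declare Scope fm_scope.
Delimit Scope fm_scope with fm.
Bind Scope fm_scope with Fm.
Notation "¬ a" := (Neg a) (at level 35, right associativity) : fm_scope.
Notation "a ∧ b" := (And a b) (at level 40, left associativity) : fm_scope.
Notation "a ∨ b" := (Or a b) (at level 50, left associativity) : fm_scope.
Notation "a ⟶ b" := (Imp a b) (at level 55, right associativity) : fm_scope.

(* A finite set of variables is represented by a list, up to [In] and [incl];
   repetitions are harmless. *)
Fixpoint var (phi : Fm) : list nat :=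
  match phi with
  | Var p => [p]
  | And a b | Or a b | Imp a b => var a ++ var b
  | Neg a | FI a | FC a => var a
  | Zero | One => []
  end.

Local Open Scope fm_scope.

Inductive axiom : Fm -> Prop :=
| A1 a : axiom (a ⟶ ¬ ¬ a)
| A2 a : axiom (¬ ¬ a ⟶ a)
| A3 a b : axiom ((a ∧ b) ⟶ b)
| A4 a b : axiom ((a ∧ b) ⟶ (b ∧ a))
| A5 a b c : axiom ((a ∧ (b ∨ c)) ⟶ ((a ∧ b) ∨ (a ∧ c)))
| A6 a b c : axiom (((a ∧ b) ∨ (a ∧ c)) ⟶ (a ∧ (b ∨ c)))
| A7 a b : axiom ((a ∨ b) ⟶ ¬ (¬ a ∧ ¬ b))
| A8 a b : axiom (¬ (¬ a ∧ ¬ b) ⟶ (a ∨ b))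
| A9 a : axiom (FC a ⟶ ¬ FI (¬ a))
| A10 a : axiom (¬ FI (¬ a) ⟶ FC a)
| A11 a : axiom (FI a ⟶ a)
| A12 a b : axiom ((FI a ∧ FI b) ⟶ FI (a ∧ b))
| A13 a b :
    axiom ((a ⟶ b) ⟶ ((¬ FI a ∨ FI b) ∧ (¬ FC a ∨ FC b)))
| A14 a b :
    axiom (((¬ FI a ∨ FI b) ∧ (¬ FC a ∨ FC b)) ⟶ (a ⟶ b)).

(* A rule relates the list of premises to the conclusion. *)
Inductive common_rule : list Fm -> Fm -> Prop :=
| R3 a b : common_rule [a] (b ⟶ a)
| R4 a b : common_rule [a ⟶ b] (¬ b ⟶ ¬ a)
| R5 a b c : common_rule [a ⟶ b; a ⟶ c] (a ⟶ (b ∧ c))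
| R6 a b c d :
    common_rule [a ⟶ b; b ⟶ a; c ⟶ d; d ⟶ c]
                ((a ⟶ c) ⟶ (b ⟶ d))
| R7 a b : common_rule [a ⟶ b] (FI a ⟶ FI b)
| R8 a : common_rule [a] (FI a)
| R9 a b : common_rule [FI a ⟶ FI b; FC a ⟶ FC b] (a ⟶ b).

Inductive HPRL_rule : list Fm -> Fm -> Prop :=
| R1 a b : HPRL_rule [a; a ⟶ b] b
| R2 a b c : HPRL_rule [a ⟶ b; b ⟶ c] (a ⟶ c)
| HPRL_common ps c : common_rule ps c -> HPRL_rule ps c.

Inductive HPRLre_rule : list Fm -> Fm -> Prop :=
| R1' a b :
    incl (var a) (var b) -> HPRLre_rule [a; a ⟶ b] b
| R2' a b c :
    incl (var b) (var a ++ var c) ->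
    HPRLre_rule [a ⟶ b; b ⟶ c] (a ⟶ c)
| HPRLre_common ps c : common_rule ps c -> HPRLre_rule ps c.

(* Every entry is an axiom instance, a hypothesis, or follows by a rule from
   earlier entries. *)
Definition derivation (rule : list Fm -> Fm -> Prop) (Gamma : Fm -> Prop)
    (s : list Fm) : Prop :=
  forall (s1 : list Fm) (psi : Fm) (s2 : list Fm), s = s1 ++ psi :: s2 ->
    axiom psi \/ Gamma psi \/ exists ps, rule ps psi /\ incl ps s1.

Definition derivable (rule : list Fm -> Fm -> Prop) (Gamma : Fm -> Prop)
    (phi : Fm) : Prop :=
  exists s : list Fm, derivation rule Gamma (s ++ [phi]).

Definition no_hyp : Fm -> Prop := fun _ => False.

Definition HPRL_theorem (phi : Fm) : Prop := derivable HPRL_rule no_hyp phi.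
Definition HPRLre_theorem (phi : Fm) : Prop :=
  derivable HPRLre_rule no_hyp phi.

(* Main.v *)
(** Theorems of HPRL^re are closed under substitution, since substituting
    preserves the inclusions of variables required by (R1') and (R2'). Hence
    (R1) is admissible: replacing by the constant [Zero] every variable of the
    theorems [a] and [a ⟶ b] that does not occur in [b] leaves [b] unchanged and
    makes the proviso of (R1') true; likewise for (R2). *)

From Stdlib Require Import List Arith.
Require Import Defs.
Import ListNotations.
Local Open Scope fm_scope.

(** Tree-shaped counterpart of [derivable]: induction on it gives an induction hypothesis for each
    premise of the last rule, which sequences do not offer directly. *)
Inductive provable (rule : list Fm -> Fm -> Prop) (Gamma : Fm -> Prop) :
    Fm -> Prop :=
| provable_axiom a : axiom a -> provable rule Gamma a
| provable_hyp a : Gamma a -> provable rule Gamma a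
| provable_rule ps c :
    rule ps c -> (forall p, In p ps -> provable rule Gamma p) ->
    provable rule Gamma c.

Lemma derivation_nil rule Gamma : derivation rule Gamma [].
Proof. intros [|x s1] psi s2 E; discriminate E. Qed.

(** A split of [s ++ [phi]] at an entry either singles out [phi] itself or comes from a split of [s]
    with the same prefix. This makes induction from the right end available for sequences. *)
Lemma derivation_snoc rule Gamma s phi :
  derivation rule Gamma (s ++ [phi]) <->
  derivation rule Gamma s /\
  (axiom phi \/ Gamma phi \/ exists ps, rule ps phi /\ incl ps s).
Proof.
  split.
  - intros H; split.
    + intros s1 psi s2 ->; apply (H s1 psi (s2 ++ [phi])).
      now rewrite <- app_assoc.
    + now apply (H s phi []).
  - intros [Hs Hphi] s1 psi s2 E.
    destruct s2 as [|x s2 _] using rev_ind.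
    + now apply app_inj_tail in E as [<- <-].
    + change (psi :: s2 ++ [x]) with ((psi :: s2) ++ [x]) in E.
      rewrite app_assoc in E; apply app_inj_tail in E as [E _].
      exact (Hs s1 psi s2 E).
Qed.

(** Premises need only occur somewhere earlier, so the entries of [t] keep their justification when
    [s] is put in front. *)
Lemma derivation_app rule Gamma s t :
  derivation rule Gamma s -> derivation rule Gamma t ->
  derivation rule Gamma (s ++ t).
Proof.
  intros Hs; induction t as [|x t IH] using rev_ind; intros Ht.
  - now rewrite app_nil_r.
  - apply derivation_snoc in Ht as [Ht Hx].
    rewrite app_assoc; apply derivation_snoc; split; [now apply IH|].
    destruct Hx as [Hx|[Hx|(ps & Hr & Hps)]]; auto.
    right; right; exists ps; split; [exact Hr|now apply incl_appr].
Qed.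

Lemma derivation_provable rule Gamma s :
  derivation rule Gamma s -> forall a, In a s -> provable rule Gamma a.
Proof.
  induction s as [|x s IH] using rev_ind; intros H a Ha; [destruct Ha|].
  apply derivation_snoc in H as [Hs Hx].
  apply in_app_or in Ha as [Ha|[<-|[]]]; [now apply IH|].
  destruct Hx as [Hx|[Hx|(ps & Hr & Hps)]].
  - now apply provable_axiom.
  - now apply provable_hyp.
  - apply (provable_rule _ _ ps); auto.
Qed.

Lemma derivation_of_derivables rule Gamma ps :
  (forall p, In p ps -> derivable rule Gamma p) ->
  exists s, derivation rule Gamma s /\ incl ps s.
Proof.
  induction ps as [|p ps IH]; intros H.
  - exists []; split; [apply derivation_nil|apply incl_refl].
  - destruct IH as (s & Hs & Hps); [intros q Hq; apply H; now right|].
    destruct (H p (or_introl eq_refl)) as [t Ht].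
    exists ((t ++ [p]) ++ s); split; [now apply derivation_app|].
    apply incl_cons; [|now apply incl_appr].
    apply in_or_app; left; apply in_or_app; right; now left.
Qed.

(** Each entry of a sequence unfolds to a tree. Conversely, the sequences for the premises of a rule
    are concatenated and the conclusion is appended. *)
Lemma derivable_iff_provable rule Gamma phi :
  derivable rule Gamma phi <-> provable rule Gamma phi.
Proof.
  split.
  - intros [s Hs]; apply (derivation_provable _ _ _ Hs).
    apply in_or_app; right; now left.
  - induction 1 as [a Ha|a Ha|ps c Hr _ IH].
    + exists []; apply derivation_snoc; split; auto using derivation_nil.
    + exists []; apply derivation_snoc; split; auto using derivation_nil.
    + destruct (derivation_of_derivables _ _ _ IH) as (s & Hs & Hps).
      exists s; apply derivation_snoc; split; [exact Hs|].
      right; right; now exists ps.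
Qed.

Lemma provable_mono (rule rule' : list Fm -> Fm -> Prop) Gamma phi :
  (forall ps c, rule ps c -> rule' ps c) ->
  provable rule Gamma phi -> provable rule' Gamma phi.
Proof.
  intros Hsub; induction 1 as [a Ha|a Ha|ps c Hr _ IH].
  - now apply provable_axiom.
  - now apply provable_hyp.
  - now apply (provable_rule _ _ ps); [apply Hsub|].
Qed.

Lemma HPRLre_rule_HPRL ps c : HPRLre_rule ps c -> HPRL_rule ps c.
Proof. destruct 1; now constructor. Qed.

Fixpoint subst (f : nat -> Fm) (phi : Fm) : Fm :=
  match phi with
  | Var p => f p
  | And a b => And (subst f a) (subst f b)
  | Or a b => Or (subst f a) (subst f b)
  | Imp a b => Imp (subst f a) (subst f b)
  | Neg a => Neg (subst f a)
  | FI a => FI (subst f a)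
  | FC a => FC (subst f a)
  | Zero => Zero
  | One => One
  end.

(** Since the variables of an instance depend only on those of the formula, inclusions between
    variable lists pass to instances by monotonicity of [flat_map]. *)
Lemma var_subst f phi :
  var (subst f phi) = flat_map (fun p => var (f p)) (var phi).
Proof.
  induction phi; simpl; rewrite ?flat_map_app, ?app_nil_r; congruence.
Qed.

Lemma subst_id f phi :
  (forall p, In p (var phi) -> f p = Var p) -> subst f phi = phi.
Proof.
  induction phi; simpl; intros H; f_equal; auto using in_or_app.
Qed.

Lemma incl_flat_map_l {A B : Type} (f : A -> list B) l l' :
  incl l l' -> incl (flat_map f l) (flat_map f l').
Proof.
  intros H x Hx; apply in_flat_map in Hx as (p & Hp & Hx).
  apply in_flat_map; exists p; auto.
Qed.

Lemma axiom_subst f a : axiom a -> axiom (subst f a).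
Proof. destruct 1; simpl; constructor. Qed.

Lemma common_rule_subst f ps c :
  common_rule ps c -> common_rule (map (subst f) ps) (subst f c).
Proof. destruct 1; simpl; constructor. Qed.

Lemma HPRLre_rule_subst f ps c :
  HPRLre_rule ps c -> HPRLre_rule (map (subst f) ps) (subst f c).
Proof.
  destruct 1 as [a b H|a b c H|ps c H]; simpl.
  - apply R1'; rewrite !var_subst; now apply incl_flat_map_l.
  - apply R2'; rewrite !var_subst, <- flat_map_app; now apply incl_flat_map_l.
  - now apply HPRLre_common, common_rule_subst.
Qed.

(** The hypothesis case is vacuous for [no_hyp]; an arbitrary set of hypotheses might not be closed
    under substitution. *)
Lemma HPRLre_provable_subst f phi :
  provable HPRLre_rule no_hyp phi -> provable HPRLre_rule no_hyp (subst f phi).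
Proof.
  induction 1 as [a Ha|a []|ps c Hr _ IH].
  - now apply provable_axiom, axiom_subst.
  - apply (provable_rule _ _ (map (subst f) ps)).
    + now apply HPRLre_rule_subst.
    + intros q Hq; apply in_map_iff in Hq as (p & <- & Hp); auto.
Qed.

(** [Zero] is a closed formula, so replacing a variable by it introduces no new variable. *)
Definition restrict (l : list nat) : Fm -> Fm :=
  subst (fun p => if in_dec Nat.eq_dec p l then Var p else Zero).

Lemma restrict_id l phi : incl (var phi) l -> restrict l phi = phi.
Proof.
  intros H; apply subst_id; intros p Hp.
  destruct (in_dec Nat.eq_dec p l) as [|n]; [reflexivity|].
  now destruct n; apply H.
Qed.

Lemma var_restrict l phi : incl (var (restrict l phi)) l.
Proof.
  intros x Hx; unfold restrict in Hx; rewrite var_subst in Hx.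
  apply in_flat_map in Hx as (p & _ & Hx).
  destruct (in_dec Nat.eq_dec p l); [destruct Hx as [<-|[]]; assumption|destruct Hx].
Qed.

Lemma HPRLre_mp a b :
  provable HPRLre_rule no_hyp a -> provable HPRLre_rule no_hyp (a ⟶ b) ->
  provable HPRLre_rule no_hyp b.
Proof.
  intros Ha Hab; set (l := var b).
  assert (Hb : restrict l b = b) by apply restrict_id, incl_refl.
  apply (provable_rule _ _ [restrict l a; restrict l a ⟶ b]).
  - apply R1', var_restrict.
  - intros p [<-|[<-|[]]]; [now apply HPRLre_provable_subst|].
    (* With [b] written as [restrict l b], the implication is by computation the restriction of
       [a ⟶ b]. *)
    rewrite <- Hb; exact (HPRLre_provable_subst _ _ Hab).
Qed.

Lemma HPRLre_trans a b c :
  provable HPRLre_rule no_hyp (a ⟶ b) -> provable HPRLre_rule no_hyp (b ⟶ c) ->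
  provable HPRLre_rule no_hyp (a ⟶ c).
Proof.
  (* Keeping the variables of both outer formulas fixes [a] and [c], so that only the middle formula
     [b] changes, in the same way in both premises. *)
  intros Hab Hbc; set (l := var a ++ var c).
  assert (Ha : restrict l a = a) by apply restrict_id, incl_appl, incl_refl.
  assert (Hc : restrict l c = c) by apply restrict_id, incl_appr, incl_refl.
  apply (provable_rule _ _ [a ⟶ restrict l b; restrict l b ⟶ c]).
  - apply R2', var_restrict.
  - intros p [<-|[<-|[]]].
    + rewrite <- Ha; exact (HPRLre_provable_subst _ _ Hab).
    + rewrite <- Hc; exact (HPRLre_provable_subst _ _ Hbc).
Qed.

(** Only (R1) and (R2) need an argument, and their admissibility applies because the induction turns
    each premise into a theorem of HPRL^re. *)
Lemma HPRL_provable_HPRLre phi :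
  provable HPRL_rule no_hyp phi -> provable HPRLre_rule no_hyp phi.
Proof.
  induction 1 as [a Ha|a []|ps c Hr _ IH]; [now apply provable_axiom|].
  destruct Hr as [a b|a b c|ps c Hr].
  - apply (HPRLre_mp a b); apply IH; simpl; auto.
  - apply (HPRLre_trans a b c); apply IH; simpl; auto.
  - now apply (provable_rule _ _ ps); [apply HPRLre_common|].
Qed.

Theorem theorem4p26 (phi : Fm) : HPRLre_theorem phi <-> HPRL_theorem phi.
Proof.
  unfold HPRLre_theorem, HPRL_theorem; rewrite !derivable_iff_provable.
  split.
  - apply provable_mono, HPRLre_rule_HPRL.
  - apply HPRL_provable_HPRLre.
Qed.
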